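(* Let $G=(V,E)$ be an oriented digraph such that its underlying undirected graph $U(G)$ is a tree. Then $G$ is an oriented interval catch digraph if and only if it does not contain any of the digraphs $D_1$, $D_2$, $K$ described below as an induced subdigraph, where edges declared undirected may have either direction: - $D_1$ has vertices $v,v_1,v_2,v_3,v_4,v_5$, arcs $v\to v_1$, $v_1\to v_2$, $v_1\to v_3$, and undirected edges $v_2v_5$, $v_3v_4$; - $D_2$ has vertices $v,v_1,v_2,v_3$, arcs $v_2\to v_1$, $v_3\to v_1$, and undirected edge $vv_1$; - $K$ has vertices $c,x',x,y',y,z',z$ and undirected edges $cx'$, $x'x$, $cy'$, $y'y$, $cz'$, $z'z$.
   Context: Digraphs are finite and simple (no loops, no multiple arcs). An oriented digraph is a digraph with no pair $u,v$ such that both $uv$ and $vu$ are arcs. The underlying graph $U(G)$ of $G=(V,E)$ is the undirected graph on $V$ in which $u,v$ are adjacent if and only if $uv\in E$ or $vu\in E$. A digraph with some undirected edges (which ''can have any direction'') stands for the family of all oriented digraphs obtained by giving each undirected edge one of its two directions; containing it as an induced subdigraph means containing an induced subdigraph isomorphic to some member of this family. A digraph $G=(V,E)$ is an interval catch digraph (ICD) if one can assign to each $u\in V$ a closed bounded interval $I_u$ of the real line and a point $p_u\in I_u$ such that for $u,v\in V$: $uv\in E$ if and only if $u\ne v$ and $p_v\in I_u$. An oriented interval catch digraph is an ICD that is an oriented digraph. *)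

(* Defs.v *)
From mathcomp Require Import all_boot all_order all_algebra.
From mathcomp Require Import reals.

Set Implicit Arguments.
Unset Strict Implicit.
Unset Printing Implicit Defensive.

Local Open Scope ring_scope.

Record digraph := Digraph {
  vertex :> finType;
  arc : rel vertex;
  arc_irrefl : irreflexive arc
}.

Arguments arc {G} : rename.

Definition oriented (G : digraph) : Prop :=
  forall u v : G, ~ (arc u v /\ arc v u).

Definition underlying (G : digraph) : rel G :=
  fun u v => arc u v || arc v u.

(* Meant for symmetric irreflexive [e]; the size bound rules out the closed
   walks [:: x; y] along a single edge, which [ucycle] accepts. *)
Definition is_tree (T : finType) (e : rel T) : Prop :=
  [/\ (0 < #|T|)%N,
      forall x y, connect e x y
    & forall c : seq T, (2 < size c)%N -> ~ ucycle e c].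

Definition is_ICD (R : realType) (G : digraph) : Prop :=
  exists (a b p : G -> R),
    (forall u, p u \in `[a u, b u]) /\
    (forall u v, arc u v <-> u <> v /\ p v \in `[a u, b u]).

Definition is_oriented_ICD (R : realType) (G : digraph) : Prop :=
  is_ICD R G /\ oriented G.

Section Induced.

Variables (G : digraph) (S : {set G}).

Definition induced_arc : rel {x : G | x \in S} :=
  fun x y => arc (val x) (val y).

Lemma induced_arc_irrefl : irreflexive induced_arc.
Proof. by move=> x; apply: arc_irrefl. Qed.

Definition induced : digraph := Digraph induced_arc_irrefl.

End Induced.

Definition digraph_iso (G H : digraph) : Prop :=
  exists f : G -> H, bijective f /\ forall x y, arc (f x) (f y) = arc x y.

(* A digraph with some undirected edges, on the vertices 0, ..., num_vertices - 1.
   Each undirected edge is listed once, as a pair in an arbitrary order. *)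
Record mixed_graph := MixedGraph {
  num_vertices : nat;
  arcs : seq (nat * nat);
  edges : seq (nat * nat)
}.

Definition has_arc (M : mixed_graph) (i j : 'I_(num_vertices M)) : bool :=
  (val i, val j) \in arcs M.

Definition has_edge (M : mixed_graph) (i j : 'I_(num_vertices M)) : bool :=
  ((val i, val j) \in edges M) || ((val j, val i) \in edges M).

(* [r] is obtained from [M] by giving each undirected edge exactly one of its
   two directions ([(+)] is exclusive or). *)
Definition orientation_of (M : mixed_graph) (r : rel 'I_(num_vertices M)) : Prop :=
  [/\ forall i j, has_arc i j -> r i j,
      forall i j, has_edge i j -> r i j (+) r j i
    & forall i j, r i j -> has_arc i j || has_edge i j].

Definition in_family (M : mixed_graph) (H : digraph) : Prop :=
  oriented H /\
  exists (r : rel 'I_(num_vertices M)) (r_irrefl : irreflexive r),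
    orientation_of r /\ digraph_iso (Digraph r_irrefl) H.

Definition contains_induced (G : digraph) (M : mixed_graph) : Prop :=
  exists S : {set G}, in_family M (induced S).

(* v, v1, v2, v3, v4, v5 are 0, 1, 2, 3, 4, 5. *)
Definition D1 : mixed_graph :=
  MixedGraph 6 [:: (0, 1); (1, 2); (1, 3)]%N [:: (2, 5); (3, 4)]%N.

(* v, v1, v2, v3 are 0, 1, 2, 3. *)
Definition D2 : mixed_graph :=
  MixedGraph 4 [:: (2, 1); (3, 1)]%N [:: (0, 1)]%N.

(* c, x', x, y', y, z', z are 0, 1, 2, 3, 4, 5, 6. *)
Definition K : mixed_graph :=
  MixedGraph 7 [::]
    [:: (0, 1); (1, 2); (0, 3); (3, 4); (0, 5); (5, 6)]%N.

(* Main.v *)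
(* An oriented digraph is an interval catch digraph iff its vertices can be
   ordered so that every vertex lying between the two ends of an arc is an
   out-neighbour of the tail of that arc.

   In such an order an in-neighbour of [c] is alone among the neighbours of [c]
   on its side of [c], and of two neighbours of [c] on the same side, the one
   closer to [c] is a leaf. Each of D1, D2, K forces two neighbours of its
   central vertex onto one side in a forbidden way.

   Conversely, take a longest path s_0, ..., s_k in the tree, whose two extremal
   arcs point inward whenever possible. Excluding K makes every vertex off the
   path a leaf hanging at some s_i. Excluding D2 and D1, such a leaf is an
   out-neighbour of s_i: otherwise s_i would have in-degree 1 and both its path
   neighbours as out-neighbours, giving D1 unless one of them is an end of the
   path, which could then be replaced by the leaf. By D2, s_i has an
   out-neighbour on the path, and the leaves at s_i are placed between s_i and
   that out-neighbour. *)
Require Import Defs.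
From mathcomp Require Import all_boot all_order all_algebra.
From mathcomp Require Import reals.
From mathcomp Require Import zify.
(* [path.v] also defines a constant [arc]. *)
Import Defs.

Set Implicit Arguments.
Unset Strict Implicit.
Unset Printing Implicit Defensive.

Import Order.TTheory GRing.Theory Num.Theory.

(** * Walks and paths in acyclic graphs *)

Fixpoint nonbacktracking (T : eqType) (s : seq T) : bool :=
  if s is x :: s' then
    (if s' is _ :: z :: _ then x != z else true) && nonbacktracking s'
  else true.

Lemma uniq_nonbacktracking (T : eqType) (s : seq T) :
  uniq s -> nonbacktracking s.
Proof.
elim: s => [//|x s IHs] /= /andP[xNs /IHs ->]; rewrite andbT.
by case: s xNs {IHs} => [|y [|z s]] //; rewrite !inE !negb_or => /and3P[].
Qed.

Section Acyclic.

Variables (T : finType) (e : rel T).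
Hypotheses (e_sym : symmetric e) (e_irr : irreflexive e).
Hypothesis acyclic : forall c : seq T, 2 < size c -> ~ ucycle e c.

(** If the first vertex recurred, the walk up to the recurrence would be closed on distinct
    vertices; irreflexivity and the absence of immediate returns make it longer than two, hence a
    cycle. *)
Lemma nonbacktracking_uniq (s : seq T) :
  sorted e s -> nonbacktracking s -> uniq s.
Proof.
elim: s => [//|x s IHs] es /= /andP[x_turn nb_s].
have us : uniq s := IHs (path_sorted es) nb_s.
rewrite us andbT; apply/negP => xs.
case/splitPr: xs us es x_turn {IHs nb_s} => p1 p2 us.
rewrite /= -cat_rcons cat_path => /andP[e_c _] x_turn.
apply: (@acyclic (x :: p1)).
  by case: p1 e_c x_turn {us} => [|y [|z p1]] //=; rewrite ?e_irr ?eqxx.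
rewrite /ucycle /cycle e_c /=.
by move: us; rewrite -cat_rcons cat_uniq rcons_uniq => /andP[].
Qed.

Lemma uniq_path_ends_nonadjacent (x : T) (p : seq T) :
  path e x p -> uniq (x :: p) -> 1 < size p -> e x (last x p) = false.
Proof.
move=> ep up sp; apply/negP => exl; apply: (@acyclic (x :: p)) => //.
by rewrite /ucycle /cycle rcons_path ep e_sym exl.
Qed.

(** The segment from [i] to [j] is itself a path, so its ends are non-adjacent once it has more than
    one edge. *)
Lemma uniq_path_induced (d : T) (s : seq T) (i j : nat) :
  sorted e s -> uniq s -> i < j < size s -> e (nth d s i) (nth d s j) ->
  j = i.+1.
Proof.
move=> es us /andP[ij js] eij; apply/eqP; rewrite eqn_leq ij andbT leqNgt.
apply/negP => ij2.
have := take_uniq (j - i) (drop_uniq i.+1 us).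
have ds : drop i s = nth d s i :: drop i.+1 s by apply: drop_nth; lia.
have up : uniq (nth d s i :: take (j - i) (drop i.+1 s)).
  have := take_uniq (j - i).+1 (drop_uniq i us); by rewrite ds.
have pp : path e (nth d s i) (take (j - i) (drop i.+1 s)).
  have := take_sorted (j - i).+1 (drop_sorted i es); by rewrite ds.
have sz : size (take (j - i) (drop i.+1 s)) = j - i.
  rewrite size_take size_drop; case: ltnP => //; lia.
have := uniq_path_ends_nonadjacent pp up; rewrite sz.
rewrite (last_nth d) sz.
have -> : j - i = (j - i.+1).+1 by lia.
rewrite /= nth_take; last lia.
rewrite nth_drop subnKC // eij => H _; suff: true = false by []; apply: H; lia.
Qed.

(** Together with [walk4] and [walk5], this derives the distinctness and non-adjacency facts of the
    small configurations below from inequalities between vertices two steps apart. *)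
Lemma walk3 (a b c : T) : e a b -> e b c -> a != c -> e a c = false.
Proof.
move=> ab bc ac.
have nb : uniq [:: a; b; c].
  by apply: nonbacktracking_uniq; rewrite /= ?ab ?bc ?ac.
by apply: (@uniq_path_ends_nonadjacent a [:: b; c]); rewrite //= ab bc.
Qed.

Lemma walk4 (a b c d : T) :
  e a b -> e b c -> e c d -> a != c -> b != d ->
  uniq [:: a; b; c; d] /\ e a d = false.
Proof.
move=> ab bc cd ac bd.
have nb : uniq [:: a; b; c; d].
  by apply: nonbacktracking_uniq; rewrite /= ?ab ?bc ?cd ?ac ?bd.
split=> //.
by apply: (@uniq_path_ends_nonadjacent a [:: b; c; d]); rewrite //= ab bc cd.
Qed.

Lemma walk5 (a b c d f : T) :
  e a b -> e b c -> e c d -> e d f -> a != c -> b != d -> c != f ->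
  uniq [:: a; b; c; d; f] /\ e a f = false.
Proof.
move=> ab bc cd df ac bd cf.
have nb : uniq [:: a; b; c; d; f].
  by apply: nonbacktracking_uniq; rewrite /= ?ab ?bc ?cd ?df ?ac ?bd ?cf.
split=> //.
by apply: (@uniq_path_ends_nonadjacent a [:: b; c; d; f]);
  rewrite //= ab bc cd df.
Qed.

End Acyclic.

(** * The underlying graph and induced containment *)

Section Underlying.

Variable G : digraph.
Implicit Types u v w : G.

Lemma underlying_sym : symmetric (@underlying G).
Proof. by move=> u v; rewrite /underlying orbC. Qed.

Lemma underlying_irr : irreflexive (@underlying G).
Proof. by move=> u; rewrite /underlying arc_irrefl. Qed.

Lemma arc_underlying u v : arc u v -> underlying u v.
Proof. by rewrite /underlying => ->. Qed.

Lemma arc_underlyingV u v : arc u v -> underlying v u.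
Proof. by rewrite /underlying orbC => ->. Qed.

Lemma arc_neq u v : arc u v -> u != v.
Proof. by apply: contraTneq => ->; rewrite arc_irrefl. Qed.

Lemma underlying_neq u v : underlying u v -> u != v.
Proof. by apply: contraTneq => ->; rewrite underlying_irr. Qed.

(** Elimination form: the subset and the isomorphism become one injection, and the directions chosen
    for undirected edges are forgotten. *)
Lemma contains_inducedE (M : mixed_graph) :
  contains_induced G M ->
  exists g : 'I_(num_vertices M) -> G,
    [/\ injective g,
        forall i j, has_arc i j -> arc (g i) (g j),
        forall i j, has_edge i j -> underlying (g i) (g j)
      & forall i j, [|| has_arc i j, has_arc j i | has_edge i j] = false ->
          underlying (g i) (g j) = false].
Proof.
move=> [S [_ [r [r_irr [[r1 r2 r3] [f [[h fK _] fr]]]]]]].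
have fE i j : arc (val (f i)) (val (f j)) = r i j by rewrite -[RHS]fr.
exists (fun i => val (f i)); split.
- by move=> i j /val_inj /(can_inj fK).
- by move=> i j /r1; rewrite fE.
- by move=> i j /r2; rewrite /underlying !fE; case: (r i j).
- move=> i j; apply: contraFF; rewrite /underlying !fE
    => /orP[/r3/orP[->|->] | /r3/orP[->|]].
  + by [].
  + by rewrite !orbT.
  + by rewrite !orbT.
  + by rewrite /has_edge orbC => ->; rewrite !orbT.
Qed.

(** Introduction form: with the vertices in a list, the conditions can be checked on concrete
    indices. Orientedness of [G] supplies the exclusive or for undirected edges. *)
Lemma contains_inducedI (d : G) (M : mixed_graph) (s : seq G) :
  oriented G -> size s = num_vertices M -> uniq s ->
  all (fun a => arc (nth d s a.1) (nth d s a.2)) (arcs M) ->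
  all (fun a => underlying (nth d s a.1) (nth d s a.2)) (edges M) ->
  (forall i j, i < j < num_vertices M -> underlying (nth d s i) (nth d s j) ->
     [|| (i, j) \in arcs M, (j, i) \in arcs M,
         (i, j) \in edges M | (j, i) \in edges M]) ->
  contains_induced G M.
Proof.
move=> orG sz us /allP sarc /allP sedge sadj.
pose g (i : 'I_(num_vertices M)) := nth d s i.
have g_inj : injective g.
  by move=> i j /eqP; rewrite nth_uniq ?sz // => /eqP/val_inj.
exists [set g i | i : 'I_(num_vertices M)]; split.
  by move=> u v; apply: orG.
pose r : rel 'I_(num_vertices M) := fun i j => arc (g i) (g j).
have r_irr : irreflexive r by move=> i; apply: arc_irrefl.
exists r, r_irr; split.
  split.
  - by move=> i j /sarc.
  - have rN i j : underlying (g i) (g j) -> r i j (+) r j i.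
      rewrite /r /underlying => /orP[] a; rewrite a;
      case: (boolP (arc _ _)) => // b;
      by case: (orG (g i) (g j)).
    move=> i j /orP[/sedge|/sedge] /=; first exact: rN.
    by move=> ?; apply: rN; rewrite underlying_sym.
  - move=> i j rij.
    (* An arc of [M] listed in the opposite direction would put both arcs in [G]. *)
    have oij : (val j, val i) \in arcs M -> False.
      by move=> /sarc /= rji; case: (orG (g i) (g j)).
    have : i != j by apply: contraTneq rij => ->; rewrite r_irr.
    rewrite -val_eqE neq_ltn => /orP[ij|ji].
      have := sadj i j; rewrite ij ltn_ord => /(_ isT (arc_underlying rij)).
      rewrite /has_arc /has_edge.
      by case/or4P => [->//|/oij//|->|->]; rewrite ?orbT.
    have := sadj j i; rewrite ji ltn_ord => /(_ isT (arc_underlyingV rij)).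
    rewrite /has_arc /has_edge.
    by case/or4P => [/oij//|->//|->|->]; rewrite ?orbT.
have gS i : g i \in [set g i | i : 'I_(num_vertices M)] by apply: imset_f.
pose f i : induced [set g i | i : 'I_(num_vertices M)] := exist _ (g i) (gS i).
exists f; split=> //.
apply: inj_card_bij => [i j /(congr1 val)/g_inj //|].
by rewrite card_sig card_imset.
Qed.

End Underlying.

(** * Recognising the forbidden digraphs in an acyclic graph *)

Ltac split_andb :=
  repeat match goal with
  | H : is_true (_ && _) |- _ => case/andP: H => ? ?
  | |- is_true (_ && _) => apply/andP; split
  end.

Section Forbidden.

Variable G : digraph.
Hypothesis orG : oriented G.
Hypothesis acyclic : forall c : seq G, 2 < size c -> ~ ucycle (@underlying G) c.

Let usym := @underlying_sym G.
Let uirr := @underlying_irr G.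

(** The neighbours [v], [u], [w] of [x] are pairwise non-adjacent, since an edge would close a
    triangle. *)
Lemma contains_D2 (v x u w : G) :
  arc u x -> arc w x -> underlying v x -> u != w -> v != u -> v != w ->
  contains_induced G D2.
Proof.
move=> ux wx vx uw vu vw.
have xu := arc_underlyingV ux; have xw := arc_underlyingV wx.
have W := walk3 usym uirr acyclic.
have n1 := W _ _ _ vx xu vu; have n2 := W _ _ _ vx xw vw.
have n3 := W _ _ _ (arc_underlying ux) xw uw.
apply: (@contains_inducedI G v D2 [:: v; x; u; w]) => //=.
- rewrite !inE !negb_or vu vw uw underlying_neq //=.
  by rewrite (underlying_neq xu) (underlying_neq xw).
- by rewrite ux wx.
- by rewrite vx.
- move=> [|[|[|[|i]]]] [|[|[|[|j]]]] /andP[] //= _ _;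
    by rewrite ?n1 ?n2 ?n3.
Qed.

(** Three inequalities suffice: [v] differs from [v2] and [v3] by orientedness, and walks through at
    most five vertices give the remaining facts. *)
Lemma contains_D1 (v v1 v2 v3 v4 v5 : G) :
  arc v v1 -> arc v1 v2 -> arc v1 v3 -> underlying v2 v5 -> underlying v3 v4 ->
  v2 != v3 -> v5 != v1 -> v4 != v1 -> contains_induced G D1.
Proof.
move=> a01 a12 a13 e25 e34 n23 n51 n41.
have e01 := arc_underlying a01; have e12 := arc_underlying a12.
have e13 := arc_underlying a13.
have n02 : v != v2.
  by apply: contraTneq a12 => <-; apply/negP => ?; case: (@orG v v1).
have n03 : v != v3.
  by apply: contraTneq a13 => <-; apply/negP => ?; case: (@orG v v1).
have W3 := walk3 usym uirr acyclic; have W4 := walk4 usym uirr acyclic.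
have e52 : underlying v5 v2 by rewrite usym.
have e21 : underlying v2 v1 by rewrite usym.
have n14 : v1 != v4 by rewrite eq_sym.
have n15 : v1 != v5 by rewrite eq_sym.
have e31 : underlying v3 v1 by rewrite usym.
have n32 : v3 != v2 by rewrite eq_sym.
have [u5 m54] := walk5 usym uirr acyclic e52 e21 e13 e34 n51 n23 n14.
have [u45 m05] := W4 _ _ _ _ e01 e12 e25 n02 n15.
have [u44 m04] := W4 _ _ _ _ e01 e13 e34 n03 n14.
have [_ m24] := W4 _ _ _ _ e21 e13 e34 n23 n14.
have [_ m35] := W4 _ _ _ _ e31 e12 e25 n32 n15.
have m02 := W3 _ _ _ e01 e12 n02; have m03 := W3 _ _ _ e01 e13 n03.
have m14 := W3 _ _ _ e13 e34 n14; have m15 := W3 _ _ _ e12 e25 n15.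
have m23 := W3 _ _ _ e21 e13 n23.
rewrite usym in m54.
apply: (@contains_inducedI G v D1 [:: v; v1; v2; v3; v4; v5]) => //=.
- move: u5 u45 u44; rewrite /= !inE !negb_or !andbT => ? ? ?.
  by split_andb; rewrite // eq_sym.
- by rewrite a01 a12 a13.
- by rewrite e25 e34.
- move=> [|[|[|[|[|[|i]]]]]] [|[|[|[|[|[|j]]]]]] /andP[] //= _ _;
    by rewrite ?m02 ?m03 ?m04 ?m05 ?m14 ?m15
      ?m23 ?m24 ?m35 ?m54 // usym ?m24 ?m35.
Qed.

Lemma contains_K (c x' x y' y z' z : G) :
  let e := @underlying G in
  e c x' -> e c y' -> e c z' -> e x' x -> e y' y -> e z' z ->
  x' != y' -> x' != z' -> y' != z' -> c != x -> c != y -> c != z ->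
  contains_induced G K.
Proof.
move=> e cx cy cz xx yy zz nxy nxz nyz ncx ncy ncz.
have W3 := walk3 usym uirr acyclic; have W4 := walk4 usym uirr acyclic.
have W5 := walk5 usym uirr acyclic.
have spoke a a' b b' : e c a' -> e c b' -> e a' a -> e b' b -> a' != b' ->
    c != a -> c != b ->
  [/\ uniq [:: a; a'; c; b'; b],
     [/\ e a b = false, e a' b = false & e a b' = false], e a' b' = false
     & e c a = false].
  move=> ca cb aa bb nab nca ncb.
  have aV : e a a' by rewrite /e usym.
  have caV : e a' c by rewrite /e usym.
  have nac : a != c by rewrite eq_sym.
  have [u f] := W5 _ _ _ _ _ aV caV cb bb nac nab ncb.
  split=> //.
  - split=> //; first by have [] := W4 _ _ _ _ caV cb bb nab ncb.
    by have [] := W4 _ _ _ _ aV caV cb nac nab.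
  - exact: W3 caV cb nab.
  - exact: W3 ca aa nca.
have [u1 [p1 p2 p3] p4 p5] := spoke _ _ _ _ cx cy xx yy nxy ncx ncy.
have [u2 [q1 q2 q3] q4 q5] := spoke _ _ _ _ cy cz yy zz nyz ncy ncz.
have nzx : z' != x' by rewrite eq_sym.
have [u3 [r1 r2 r3] r4 r5] := spoke _ _ _ _ cz cx zz xx nzx ncz ncx.
move: (p1, p2, p3, p4, p5, (q1, q2, q3, q4, q5), (r1, r2, r3, r4, r5)) => nadj.
apply: (@contains_inducedI G c K [:: c; x'; x; y'; y; z'; z]) => //=.
- move: u1 u2 u3; rewrite /= !inE !negb_or !andbT => ? ? ?.
  by split_andb; rewrite // eq_sym.
- by rewrite -/e cx cy cz xx yy zz.
- move=> [|[|[|[|[|[|[|i]]]]]]] [|[|[|[|[|[|[|j]]]]]]] /andP[] //= _ _;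
    by rewrite -/e ?nadj // /e usym -/e ?nadj //.
Qed.
End Forbidden.

(** * Vertex orders exclude the forbidden digraphs *)

Section Order.

Variables (R : realType) (G : digraph) (p : G -> R).
Hypothesis orG : oriented G.
Hypothesis p_inj : injective p.
Hypothesis p_between : forall u w y : G, arc u w ->
  (p u < p y < p w)%R || (p w < p y < p u)%R -> arc u y.

Lemma between_sym (u w y : G) : arc w u ->
  (p u < p y < p w)%R || (p w < p y < p u)%R -> arc w y.
Proof. by move=> wu; rewrite orbC; apply: p_between wu. Qed.

(** The disjuncts are grouped by which of [a] and [b] is nearer to [c], the case split used
    below. *)
Lemma same_side (c a b : G) : a != c -> b != c -> a != b ->
  (p a < p c)%R = (p b < p c)%R ->
  [|| (p c < p a < p b)%R || (p b < p a < p c)%R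
    | (p c < p b < p a)%R || (p a < p b < p c)%R].
Proof.
rewrite -!(inj_eq p_inj).
by case: (ltgtP (p a) (p c)); case: (ltgtP (p b) (p c));
  case: (ltgtP (p a) (p b)).
Qed.

(** If [v] is nearer to [c], an arc from [w] to [c] forces one from [w] to [v], and an arc from [c]
    to [w] forces one from [c] to [v], against orientedness. If [w] is nearer, the arc from [v] to
    [c] forces one from [v] to [w]. *)
Lemma in_neighbor_alone (c v w : G) :
  arc v c -> underlying w c -> v != w -> underlying v w = false ->
  (p v < p c)%R = (p w < p c)%R -> False.
Proof.
move=> vc wc vw nvw.
move/(same_side (arc_neq vc) (underlying_neq wc) vw) => /orP[B|B].
  case/orP: wc => [wc|cw].
    have := between_sym wc B.
    by move/arc_underlyingV; rewrite nvw.
  by have := p_between cw B => cv; case: (@orG v c).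
have := between_sym vc B.
by move/arc_underlying; rewrite nvw.
Qed.

(** As [a] lies between [c] and [b], [c] points to both, and no place is left for [d]: between [c]
    and [b] it would be an out-neighbour of [c]; beyond [b], or on the other side of [c], the edge
    joining [a] and [d] would reach over [b] or [c] and force a forbidden arc. *)
Lemma extended_neighbor_last (c a b d : G) :
  underlying c a -> underlying c b -> underlying a d -> d != c -> a != b ->
  underlying a b = false -> underlying c d = false -> underlying d b = false ->
  (p c < p a < p b)%R || (p b < p a < p c)%R -> False.
Proof.
move=> ca cb ad dc ab nab ncd ndb B.
have cab : arc c b /\ arc c a.
  case/orP: cb => [cb|bc]; first by split=> //; apply: p_between cb B.
  have := between_sym bc B.
  by move/arc_underlyingV; rewrite nab.
have {cb} [cb cca] := cab.
have edge_between u w y : underlying u w ->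
    (p u < p y < p w)%R || (p w < p y < p u)%R ->
    underlying u y || underlying w y.
  case/orP => [uw|wu] Hb; first by rewrite (arc_underlying (p_between uw Hb)).
  by rewrite (arc_underlying (between_sym wu Hb)) orbT.
have db : d != b.
  by apply: contraFneq ncd => ->; apply: arc_underlying.
have da : d != a by rewrite eq_sym underlying_neq.
have C1 : (p c < p d < p b)%R || (p b < p d < p c)%R = false.
  by apply/negP => /(p_between cb) /arc_underlying; rewrite ncd.
have C2 : (p a < p b < p d)%R || (p d < p b < p a)%R = false.
  by apply/negP => /(edge_between _ _ _ ad); rewrite nab ndb.
have C3 : (p d < p c < p a)%R || (p a < p c < p d)%R = false.
  apply/negP => H; case/orP: ad => [ad|da'].
    have := between_sym ad H => ac; case: (@orG a c); split=> //.
  by move: (p_between da' H) => /arc_underlyingV; rewrite ncd.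
move: db da dc B C1 C2 C3; rewrite -!(inj_eq p_inj).
case: (ltgtP (p d) (p b)); case: (ltgtP (p d) (p a)); case: (ltgtP (p d) (p c));
case: (ltgtP (p c) (p a)); case: (ltgtP (p a) (p b));
case: (ltgtP (p c) (p b)) => //=.
Qed.

Lemma extended_neighbors_opposite (c a a' b b' : G) :
  underlying c a -> underlying c b -> underlying a a' -> underlying b b' ->
  a' != c -> b' != c -> a != b -> underlying a b = false ->
  underlying c a' = false -> underlying c b' = false ->
  underlying a' b = false -> underlying b' a = false ->
  (p a < p c)%R = (p b < p c)%R -> False.
Proof.
move=> ca cb aa bb na nb nab fab fca fcb fa'b fb'a S.
have ac : a != c by rewrite eq_sym underlying_neq.
have bc : b != c by rewrite eq_sym underlying_neq.
case/orP: (same_side ac bc nab S).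
  exact: extended_neighbor_last ca cb aa na nab fab fca fa'b.
apply: extended_neighbor_last cb ca bb nb _ _ fcb fb'a; first by rewrite eq_sym.
by rewrite underlying_sym.
Qed.

(** Two of the three neighbours of the centre share a side, and every pair of them contains an
    in-neighbour. *)
Lemma D2_free : ~ contains_induced G D2.
Proof.
move=> /contains_inducedE [g [g_inj ga ge gn]].
pose v0 : 'I_(num_vertices D2) := @Ordinal 4 0 isT.
pose v1 : 'I_(num_vertices D2) := @Ordinal 4 1 isT.
pose v2 : 'I_(num_vertices D2) := @Ordinal 4 2 isT.
pose v3 : 'I_(num_vertices D2) := @Ordinal 4 3 isT.
have gneq i j : i != j -> g i != g j by apply: contraNneq => /g_inj ->.
have a21 : arc (g v2) (g v1) by apply: ga.
have a31 : arc (g v3) (g v1) by apply: ga.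
have e01 : underlying (g v0) (g v1) by apply: ge.
have alone v w := @in_neighbor_alone (g v1) (g v) (g w).
have [s23|s23] := eqVneq (p (g v2) < p (g v1))%R (p (g v3) < p (g v1))%R.
  exact: alone _ _ a21 (arc_underlying a31) (gneq v2 v3 isT)
    (gn v2 v3 erefl) s23.
have [s20|s20] := eqVneq (p (g v2) < p (g v1))%R (p (g v0) < p (g v1))%R.
  exact: alone _ _ a21 e01 (gneq v2 v0 isT) (gn v2 v0 erefl) s20.
apply: alone _ _ a31 e01 (gneq v3 v0 isT) (gn v3 v0 erefl) _.
by move: s23 s20; do 3!case: (_ < _)%R.
Qed.

(** The in-neighbour [v0] is alone on its side, so [v2] and [v3], neither of them a leaf, share the
    other side. *)
Lemma D1_free : ~ contains_induced G D1.
Proof.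
move=> /contains_inducedE [g [g_inj ga ge gn]].
pose v0 : 'I_(num_vertices D1) := @Ordinal 6 0 isT.
pose v1 : 'I_(num_vertices D1) := @Ordinal 6 1 isT.
pose v2 : 'I_(num_vertices D1) := @Ordinal 6 2 isT.
pose v3 : 'I_(num_vertices D1) := @Ordinal 6 3 isT.
pose v4 : 'I_(num_vertices D1) := @Ordinal 6 4 isT.
pose v5 : 'I_(num_vertices D1) := @Ordinal 6 5 isT.
have gneq i j : i != j -> g i != g j by apply: contraNneq => /g_inj ->.
have a01 : arc (g v0) (g v1) by apply: ga.
have e12 : underlying (g v1) (g v2) by apply/arc_underlying/ga.
have e13 : underlying (g v1) (g v3) by apply/arc_underlying/ga.
have e25 : underlying (g v2) (g v5) by apply: ge.
have e34 : underlying (g v3) (g v4) by apply: ge.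
have alone w := @in_neighbor_alone (g v1) (g v0) (g w) a01.
have [s02|s02] := eqVneq (p (g v0) < p (g v1))%R (p (g v2) < p (g v1))%R.
  apply: alone _ _ (gneq v0 v2 isT) (gn v0 v2 erefl) s02.
  by rewrite underlying_sym.
have [s03|s03] := eqVneq (p (g v0) < p (g v1))%R (p (g v3) < p (g v1))%R.
  apply: alone _ _ (gneq v0 v3 isT) (gn v0 v3 erefl) s03.
  by rewrite underlying_sym.
apply: (extended_neighbors_opposite e12 e13 e25 e34);
  try exact: gneq; try exact: gn.
by move: s02 s03; do 3!case: (_ < _)%R.
Qed.

(** Two of the three neighbours of the centre share a side, and none of them is a leaf. *)
Lemma K_free : ~ contains_induced G K.
Proof.
move=> /contains_inducedE [g [g_inj ga ge gn]].
pose v0 : 'I_(num_vertices K) := @Ordinal 7 0 isT.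
pose v1 : 'I_(num_vertices K) := @Ordinal 7 1 isT.
pose v2 : 'I_(num_vertices K) := @Ordinal 7 2 isT.
pose v3 : 'I_(num_vertices K) := @Ordinal 7 3 isT.
pose v4 : 'I_(num_vertices K) := @Ordinal 7 4 isT.
pose v5 : 'I_(num_vertices K) := @Ordinal 7 5 isT.
pose v6 : 'I_(num_vertices K) := @Ordinal 7 6 isT.
have gneq i j : i != j -> g i != g j by apply: contraNneq => /g_inj ->.
have e01 : underlying (g v0) (g v1) by apply: ge.
have e12 : underlying (g v1) (g v2) by apply: ge.
have e03 : underlying (g v0) (g v3) by apply: ge.
have e34 : underlying (g v3) (g v4) by apply: ge.
have e05 : underlying (g v0) (g v5) by apply: ge.
have e56 : underlying (g v5) (g v6) by apply: ge.
have [s13|s13] := eqVneq (p (g v1) < p (g v0))%R (p (g v3) < p (g v0))%R.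
  by apply: (extended_neighbors_opposite e01 e03 e12 e34 _ _ _ _ _ _ _ _ s13);
    try exact: gneq; try exact: gn.
have [s15|s15] := eqVneq (p (g v1) < p (g v0))%R (p (g v5) < p (g v0))%R.
  by apply: (extended_neighbors_opposite e01 e05 e12 e56 _ _ _ _ _ _ _ _ s15);
    try exact: gneq; try exact: gn.
apply: (extended_neighbors_opposite e03 e05 e34 e56);
  try exact: gneq; try exact: gn.
by move: s13 s15; do 3!case: (_ < _)%R.
Qed.

End Order.

(** * Interval catch digraphs as vertex orders *)

Lemma ICD_order (R : realType) (G : digraph) :
  is_oriented_ICD R G ->
  exists p : G -> R, injective p /\ forall u w y : G, arc u w ->
    (p u < p y < p w)%R || (p w < p y < p u)%R -> arc u y.
Proof.
move=> [[a [b [p [pI arcI]]]] orG]; exists p; split.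
  (* Two vertices with the same point would catch each other, against orientedness. *)
  move=> u v puv; apply/eqP; apply: contraT => /eqP uv.
  case: (orG u v); split; apply/arcI; split; rewrite -?puv //;
    last by rewrite puv.
  by move=> vu; apply: uv.
move=> u w y /arcI[uw pw] B; apply/arcI; split.
  by move=> uy; move: B; rewrite uy !ltxx /= andbF.
move: (pI u) pw B; rewrite !in_itv /= => /andP[au ub] /andP[aw wb].
case/orP => /andP[/ltW h1 /ltW h2].
  by rewrite (le_trans au h1) (le_trans h2 wb).
by rewrite (le_trans aw h1) (le_trans h2 ub).
Qed.

(** Each interval spans the extreme positions in the closed out-neighbourhood [N u]; this set is
    convex in the order, so the interval catches nothing else. *)
Lemma order_ICD (R : realType) (G : digraph) (pos : G -> nat) :
  injective pos ->
  (forall u w y : G, arc u w ->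
     (pos u < pos y < pos w) || (pos w < pos y < pos u) -> arc u y) ->
  is_ICD R G.
Proof.
move=> pos_inj pos_between.
pose N u : pred G := fun x => (x == u) || arc u x.
have Nu u : N u u by rewrite /N eqxx.
have Nconvex u x y z : N u x -> N u z -> pos x <= pos y <= pos z -> N u y.
  (* Convexity is first shown for ranges with [u] at one end; in general [y] lies between [u] and
     one of [x], [z]. *)
  have half w : N u w ->
      (pos u <= pos y <= pos w) || (pos w <= pos y <= pos u) ->
      N u y.
    have [-> //|yu] := eqVneq y u; have [-> //|yw] := eqVneq y w.
    rewrite /N; case/orP => [/eqP->|uw] B.
      by case/eqP: yu; apply: pos_inj; lia.
    apply/orP; right; apply: pos_between uw _.
    have : pos y <> pos u by move/pos_inj/eqP; rewrite (negPf yu).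
    have : pos y <> pos w by move/pos_inj/eqP; rewrite (negPf yw).
    by lia.
  move=> ux uz B; case: (leqP (pos u) (pos y)) => uy.
    by apply: (half z uz); lia.
  by apply: (half x ux); lia.
pose mn u := pos [arg min_(x < u | N u x) pos x].
pose mx u := pos [arg max_(x > u | N u x) pos x].
have I u y : (((pos y)%:R : R) \in `[(mn u)%:R, (mx u)%:R])%R = N u y.
  rewrite in_itv /= !ler_nat /mn /mx.
  case: arg_minnP => // x ux xmin; case: arg_maxnP => // z uz zmax.
  apply/idP/idP; first exact: Nconvex.
  by move=> uy; rewrite xmin //; apply: zmax.
exists (fun u => (mn u)%:R)%R, (fun u => (mx u)%:R)%R, (fun u => (pos u)%:R)%R.
split=> [u|u v]; rewrite I //; split.
  by move=> uv; rewrite /N uv orbT; split=> // /eqP; apply/negP/arc_neq.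
by case=> /eqP uv; rewrite /N eq_sym (negPf uv).
Qed.

(** * Longest paths and the leaves hanging from them *)

Section LongestPath.

Variable G : digraph.
Local Notation e := (@underlying G).
Hypothesis orG : oriented G.
Hypothesis acyclic : forall c : seq G, 2 < size c -> ~ ucycle e c.
Hypothesis connected : forall x y, connect e x y.
Hypothesis noD1 : ~ contains_induced G D1.
Hypothesis noD2 : ~ contains_induced G D2.
Hypothesis noK : ~ contains_induced G K.
Variable d : G.

Let e_sym : symmetric e := @underlying_sym G.
Let e_irr : irreflexive e := @underlying_irr G.

Definition upath (s : seq G) : bool := sorted (@underlying G) s && uniq s.

(** On a one-vertex path the second entry is the default [d]. The value is inspected only on paths
    of at least three vertices; elsewhere it matters only that it adds at most one. *)
Definition head_inward (s : seq G) : bool := arc (nth d s 0) (nth d s 1).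

(* Length comes first; the two booleans break ties. *)
Definition weight (s : seq G) : nat :=
  3 * size s + head_inward s + head_inward (rev s).

Definition maximal (s : seq G) : Prop :=
  upath s /\ forall t, upath t -> weight t <= weight s.

Lemma upath_rev s : upath (rev s) = upath s.
Proof.
rewrite /upath rev_uniq rev_sorted; congr (_ && _).
by apply: eq_sorted => x y; rewrite underlying_sym.
Qed.

Lemma maximal_rev s : maximal s -> maximal (rev s).
Proof.
move=> [us smax]; split=> [|t /smax]; first by rewrite upath_rev.
by rewrite /weight revK size_rev; lia.
Qed.

Lemma maximal_size s t : maximal s -> upath t -> size t <= size s.
Proof.
move=> [_ smax] /smax; rewrite /weight.
by do 4!case: head_inward; lia.
Qed.

(** A path repeats no vertex, so it fits in a sequence of length at most [#|G|]; such sequences form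
    a finite type, where a heaviest path exists. *)
Lemma maximal_exists : exists s, maximal s.
Proof.
have fit t : upath t -> size t <= #|G|.
  by case/andP => _ /card_uniqP <-; apply: max_card.
pose P (t : {bseq #|G| of G}) := upath t.
have P0 : P [bseq] by [].
case: (arg_maxnP (fun t : {bseq #|G| of G} => weight t) P0) => s us smax.
exists s; split=> // t ut.
exact: (smax (Bseq (fit t ut)) ut).
Qed.

Lemma neighbor_index s i j :
  upath s -> i < size s -> j < size s -> e (nth d s i) (nth d s j) ->
  j = i.+1 \/ i = j.+1.
Proof.
case/andP => es us iS jS eij; case: (ltngtP i j) => [ij|ji|ij].
- by left; apply: (uniq_path_induced e_sym acyclic es us _ eij); rewrite ij.
- right; rewrite e_sym in eij.
  by apply: (uniq_path_induced e_sym acyclic es us _ eij); rewrite ji.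
- by rewrite ij underlying_irr in eij.
Qed.

Lemma path_edge s i : upath s -> i.+1 < size s -> e (nth d s i) (nth d s i.+1).
Proof. by case/andP => /sortedP es _ iS; apply: es. Qed.

Lemma upath_nth_neq s i j : upath s -> i < size s -> j < size s -> i != j ->
  nth d s i != nth d s j.
Proof. by case/andP => _ us iS jS; rewrite nth_uniq. Qed.

Section PathStart.

Variable s : seq G.
Hypothesis s_max : maximal s.
Let s_path : upath s := proj1 s_max.

Lemma maximal_nonempty : 0 < size s.
Proof. exact: (maximal_size s_max (t := [:: d])). Qed.

Variables (w : G) (i : nat).
Hypotheses (ws : w \notin s) (iS : i < size s) (wi : e w (nth d s i)).

(** Otherwise [w] could be prepended to the path. *)
Lemma off_path_gt0 : 0 < i.
Proof.
move: ws iS wi; case: i => // ws' S0 w0.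
have : upath (w :: s).
  move: s_path w0 ws'; rewrite /upath; case: s S0 => //= x t _.
  move=> /andP[-> /andP[-> ->]] -> ->.
  by [].
by move/(maximal_size s_max); rewrite /= ltnn.
Qed.

(** Replacing the first vertex of the path by [z] and [w] would lengthen it. *)
Lemma off_path_no_neighbor1 z : i = 1 -> e w z -> z = nth d s i.
Proof.
move=> i1 wz; move: wi; rewrite i1 => w1; apply/eqP; apply: contraT => z1.
have : upath (z :: w :: behead s).
  move: s_path w1 ws z1 iS (maximal_nonempty); rewrite i1 /upath.
  case: s => [|x [|y t]] //= /andP[/andP[xy yt] /andP[_ uyt]] wy.
  rewrite !inE !negb_or => /and3P[wx wny wt] zy _ _.
  have p2 : path e z [:: w, y & t] by rewrite /= e_sym wz wy.
  suff u2 : uniq [:: z, w, y & t].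
    by apply/andP; split; [exact: p2 | move: u2; rewrite /= !inE !negb_or].
  (* A priori [z] may lie on the path; acyclicity still rules out repetitions in a walk without
     immediate returns. *)
  apply: (nonbacktracking_uniq e_irr acyclic (s := [:: z, w, y & t]) p2).
  rewrite /= zy; have := uniq_nonbacktracking (s := y :: t) uyt => /= ->.
  rewrite andbT.
  by case: t wt {yt uyt p2} => //= a t; rewrite inE negb_or => /andP[].
move/(maximal_size s_max); rewrite /= size_behead.
by move: (maximal_nonempty); lia.
Qed.

End PathStart.

Section OffPath.

Variable s : seq G.
Hypothesis s_max : maximal s.
Let s_path : upath s := proj1 s_max.

Lemma nth_rev_index i : i < size s ->
  nth d s i = nth d (rev s) (size s - i.+1).
Proof. by move=> iS; rewrite nth_rev; [congr nth; lia | lia]. Qed.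

Lemma off_path_lt_last w i : w \notin s -> i < size s -> e w (nth d s i) ->
  i.+1 < size s.
Proof.
move=> ws iS wi;
have := @off_path_gt0 (rev s) (maximal_rev s_max) w (size s - i.+1).
rewrite mem_rev size_rev -nth_rev_index // => /(_ ws).
by rewrite subn_gt0; apply=> //; lia.
Qed.

(** Next to an end of the path, another neighbour would allow a longer path. Elsewhere, two path
    vertices on each side, together with [w] and [z], give the three legs of [K]. *)
Lemma off_path_leaf w i z : w \notin s -> i < size s -> e w (nth d s i) ->
  e w z -> z = nth d s i.
Proof.
move=> ws iS wi wz.
have i0 := off_path_gt0 s_max ws iS wi; have iS1 := off_path_lt_last ws iS wi.
have [i1|i1] := eqVneq i 1.
  exact: (off_path_no_neighbor1 s_max ws iS wi i1 wz).
have [il|il] := eqVneq i.+2 (size s).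
  rewrite nth_rev_index //.
  apply: (@off_path_no_neighbor1 _ (maximal_rev s_max) w) => //.
  - by rewrite mem_rev.
  - by rewrite size_rev; lia.
  - by rewrite -nth_rev_index.
  - by lia.
apply/eqP; apply: contraT => zi; case: noK.
have sub k : i.-1 = k -> e (nth d s i) (nth d s k).
  move=> <-; rewrite e_sym -[in nth d s i](prednK i0).
  by apply: path_edge => //; lia.
have wn k : k < size s -> nth d s k != w.
  by move=> kS; apply: contraNneq ws => <-; apply: mem_nth.
apply: (@contains_K _ orG acyclic (nth d s i) (nth d s i.-1) (nth d s i.-2)
  (nth d s i.+1) (nth d s i.+2) w z).
- exact: sub.
- exact: path_edge.
- by rewrite underlying_sym.
- rewrite underlying_sym -[in nth d s i.-1](@prednK i.-1); last lia.
  by apply: path_edge => //; lia.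
- by apply: path_edge => //; lia.
- by [].
- by apply: upath_nth_neq => //; lia.
- by apply: wn; lia.
- by apply: wn; lia.
- by apply: upath_nth_neq => //; lia.
- by apply: upath_nth_neq => //; lia.
- by rewrite eq_sym.
Qed.

(** By [off_path_leaf], the vertices on or adjacent to the path are closed under adjacency, so by
    connectedness they are all the vertices. *)
Lemma attached w : w \notin s -> exists2 i, i < size s & e w (nth d s i).
Proof.
pose A : pred G := fun x => (x \in s) || has (e x) s.
have S0 := maximal_nonempty s_max.
have Acl : closed e A.
  apply: intro_closed => [|x y xy]; first exact: sym_connect_sym.
  rewrite -![_ \in A]/(A _) /A; case: (boolP (y \in s)) => //= ys.
  case/orP => [xs|].
    by apply/hasP; exists x => //; rewrite e_sym.
  case: (boolP (x \in s)) => [xs _|xs].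
    by apply/hasP; exists x => //; rewrite e_sym.
  case/(has_nthP d) => i iS xi.
  have yE := off_path_leaf xs iS xi xy.
  by rewrite yE mem_nth in ys.
move=> ws; have := closed_connect Acl (connected (nth d s 0) w).
rewrite -![_ \in A]/(A _) /A (mem_nth d S0) (negPf ws) /=.
move=> /esym /(has_nthP d) [i iS wi].
by exists i.
Qed.

(** Exchanging the first vertex for [w] would keep the length and turn that end inward, increasing
    the weight. *)
Lemma off_path_in_neighbor1 w : w \notin s -> 1 < size s -> e w (nth d s 1) ->
  arc (nth d s 1) (nth d s 0) -> ~~ arc w (nth d s 1).
Proof.
move=> ws S1 w1 a10; apply/negP => aw1.
(* With at least three vertices, the exchange leaves the last two, hence the other boolean,
   unchanged. *)
have S2 := off_path_lt_last ws S1 w1.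
have : upath (w :: behead s).
  move: s_path w1 ws S1; rewrite /upath.
  case: s => [|x [|y t]] //= /andP[/andP[xy ->] /andP[_ ->]] -> ws' _.
  by move: ws'; rewrite !inE !negb_or => /and3P[_ -> ->].
case: s_max => _ smax /smax.
have a01 : arc (nth d s 0) (nth d s 1) = false.
  by apply/negP => ?; case: (@orG (nth d s 0) (nth d s 1)).
rewrite /weight /head_inward a01 /= !nth_rev /= ?size_behead; try lia.
case: s S2 aw1 => [|x [|y [|z t]]] //= _ ->.
by rewrite addn0 addn1 addSn ltnn.
Qed.

End OffPath.

Section OffPathArcs.

Variable s : seq G.
Hypothesis s_max : maximal s.
Let s_path : upath s := proj1 s_max.
Variables (w : G) (i : nat).
Hypotheses (ws : w \notin s) (iS : i < size s) (wi : e w (nth d s i)).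

Let i_gt0 : 0 < i := off_path_gt0 s_max ws iS wi.
Let i_lt : i.+1 < size s := off_path_lt_last s_max ws iS wi.
Let w_neq k : k < size s -> w != nth d s k.
Proof. by move=> kS; apply: contraNneq ws => ->; apply: mem_nth. Qed.

Let e_next : e (nth d s i) (nth d s i.+1).
Proof. exact: path_edge. Qed.

Let e_prev : e (nth d s i) (nth d s i.-1).
Proof.
rewrite e_sym -[in nth d s i](prednK i_gt0); apply: path_edge => //; lia.
Qed.

Lemma off_path_out : arc (nth d s i) w.
Proof.
case/orP: wi => // aw.
(* A path neighbour of index [k] pointing inward, the in-neighbour [w] and the other path neighbour,
   of index [j], would give [D2]. *)
have out k : k != i -> k < size s -> e (nth d s i) (nth d s k) ->
    arc (nth d s i) (nth d s k).
  move=> ki kS; case/orP => // ak.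
  have [j [jS ji jk ej]] : exists j,
      [/\ j < size s, j != i, j != k & e (nth d s j) (nth d s i)].
    have [->|km] := eqVneq k i.+1.
      by exists i.-1; rewrite e_sym e_prev; split=> //; lia.
    exists i.+1; rewrite e_sym e_next; split=> //; lia.
  case: noD2; apply: (@contains_D2 _ orG acyclic (nth d s j) (nth d s i)
    w (nth d s k)) => //.
  - exact: w_neq.
  - by rewrite eq_sym w_neq.
  - exact: upath_nth_neq.
have aN : arc (nth d s i) (nth d s i.+1) by apply: out => //; lia.
have aP : arc (nth d s i) (nth d s i.-1) by apply: out => //; lia.
(* Next to an end of the path a leg of [D1] is missing, and the exchange of that end for [w] applies
   instead. *)
have [i1|i1] := eqVneq i 1.
  move: wi aP aw (iS); rewrite i1 => w1 a10 aw1 S1.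
  by have := off_path_in_neighbor1 s_max ws S1 w1 a10; rewrite aw1.
have [il|il] := eqVneq i.+2 (size s).
  have := @off_path_in_neighbor1 _ (maximal_rev s_max) w.
  rewrite mem_rev size_rev.
  have -> : nth d (rev s) 1 = nth d s i.
    by rewrite nth_rev; [congr nth; lia | lia].
  have -> : nth d (rev s) 0 = nth d s i.+1.
    by rewrite nth_rev; [congr nth; lia | lia].
  by rewrite aw => H; suff: false by []; apply: H => //; lia.
case: noD1.
apply: (@contains_D1 _ orG acyclic w (nth d s i) (nth d s i.-1) (nth d s i.+1)
  (nth d s i.+2) (nth d s i.-2)) => //.
- rewrite underlying_sym -[in nth d s i.-1](@prednK i.-1); last lia.
  by apply: path_edge => //; lia.
- by apply: path_edge => //; lia.
- by apply: upath_nth_neq => //; lia.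
- by apply: upath_nth_neq => //; lia.
- by apply: upath_nth_neq => //; lia.
Qed.

(** If both path neighbours pointed inward, they would form [D2] with [w]. *)
Lemma off_path_tail :
  arc (nth d s i) (nth d s i.+1) || arc (nth d s i) (nth d s i.-1).
Proof.
case/orP: e_next => [->//|aN].
case/orP: e_prev => [->|aP]; first by rewrite orbT.
case: noD2.
apply: (@contains_D2 _ orG acyclic w (nth d s i)
  (nth d s i.-1) (nth d s i.+1)) => //.
- by apply: upath_nth_neq => //; lia.
- by apply: w_neq; lia.
- exact: w_neq.
Qed.

End OffPathArcs.
End LongestPath.

(** * Placing all vertices on a line *)

Section Position.

Variable G : digraph.
Local Notation e := (@underlying G).
Hypothesis orG : oriented G.
Hypothesis acyclic : forall c : seq G, 2 < size c -> ~ ucycle e c.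
Hypothesis connected : forall x y, connect e x y.
Hypothesis noD1 : ~ contains_induced G D1.
Hypothesis noD2 : ~ contains_induced G D2.
Hypothesis noK : ~ contains_induced G K.
Variables (d : G) (s : seq G).
Hypothesis s_max : maximal d s.
Let s_path : upath s := proj1 s_max.

(* The index of [v] on the path or, for [v] off the path, of its neighbour. *)
Definition path_index (v : G) : nat :=
  if v \in s then index v s else find (underlying v) s.

(* Consecutive path vertices are [2 * #|G|.+1] apart, so that the leaves placed
   on either side of a gap stay in their own half. *)
Definition position (v : G) : nat :=
  let i := path_index v in
  let c := (2 * #|G|.+1) * i.+1 in
  if v \in s then c
  else if arc (nth d s i) (nth d s i.+1) then c + (enum_rank v).+1
  else c - (enum_rank v).+1.

(** Each form of the position comes with the arcs that justify it: a leaf is placed towards a path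
    out-neighbour of the vertex it hangs from. *)
Variant position_spec (v : G) (i : nat) : nat -> Prop :=
| PositionOn of v = nth d s i :
    position_spec v i ((2 * #|G|.+1) * i.+1)
| PositionAfter of v \notin s & arc (nth d s i) v
    & arc (nth d s i) (nth d s i.+1) & i.+1 < size s :
    position_spec v i ((2 * #|G|.+1) * i.+1 + (enum_rank v).+1)
| PositionBefore of v \notin s & arc (nth d s i) v
    & arc (nth d s i) (nth d s i.-1) & 0 < i :
    position_spec v i ((2 * #|G|.+1) * i.+1 - (enum_rank v).+1).

Lemma path_index_lt v : path_index v < size s.
Proof.
rewrite /path_index; case: (boolP (v \in s)) => vs; first by rewrite index_mem.
have [i iS vi] := attached orG acyclic connected noK s_max vs.
by rewrite -has_find; apply/(has_nthP d); exists i.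
Qed.

Lemma off_path_edge v : v \notin s -> e v (nth d s (path_index v)).
Proof.
move=> vs; have := path_index_lt v; rewrite /path_index (negPf vs) -has_find.
exact: nth_find.
Qed.

Lemma positionP v : position_spec v (path_index v) (position v).
Proof.
rewrite /position; have iS := path_index_lt v.
case: (boolP (v \in s)) => vs.
  by constructor; rewrite /path_index vs nth_index.
have vi := off_path_edge vs.
have out := off_path_out orG acyclic noD1 noD2 s_max vs iS vi.
have tl := off_path_tail orG acyclic noD2 s_max vs iS vi.
case: ifP tl => [a _|_ /= a]; constructor=> //.
  exact: (off_path_lt_last s_max vs iS vi).
exact: (off_path_gt0 s_max vs iS vi).
Qed.

Lemma path_index_nth i : i < size s -> path_index (nth d s i) = i.
Proof.
move=> iS; rewrite /path_index mem_nth // index_uniq //.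
by case/andP: s_path.
Qed.

Lemma rank_lt (v : G) : enum_rank v < #|G|.
Proof. exact: ltn_ord. Qed.

(** Offsets are at most [#|G|], less than half the spacing, so the subtraction never truncates and
    vertices of different indices occupy disjoint blocks in the order of the indices. *)
Lemma path_index_le u v :
  position u <= position v -> path_index u <= path_index v.
Proof.
have := rank_lt u; have := rank_lt v.
by case: (positionP u); case: (positionP v) => *; nia.
Qed.

(** Equal positions force the same index and the same side, after which [enum_rank] separates the
    leaves. *)
Lemma position_inj : injective position.
Proof.
move=> u v puv.
have iuv : path_index u = path_index v.
  by apply/eqP; rewrite eqn_leq !path_index_le ?puv.
have := rank_lt u; have := rank_lt v.
case: (positionP u) (positionP v) puv
  => [un|us _ _ _|us _ _ _] [vn|vs _ _ _|vs _ _ _];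
  rewrite iuv => puv ru rv; try nia.
- by rewrite un vn iuv.
- by apply/enum_rank_inj/ord_inj; nia.
- by apply/enum_rank_inj/ord_inj; nia.
Qed.

Lemma position_between u w y : arc u w ->
  (position u < position y < position w) ||
  (position w < position y < position u) ->
  arc u y.
Proof.
move=> uw B.
have no_back (a b : G) : arc a b -> arc b a -> False.
  by move=> *; case: (@orG a b).
(* The only arc at a vertex off the path is incoming, so such a vertex is not a tail. *)
have us : u \in s.
  apply: contraT => us; have iS := path_index_lt u; have ui := off_path_edge us.
  have wE := off_path_leaf orG acyclic noK s_max us iS ui (arc_underlying uw).
  have := off_path_out orG acyclic noD1 noD2 s_max us iS ui; rewrite -wE => wu.
  by case: (no_back u w).
have uS := path_index_lt u; have wS := path_index_lt w.
have uE : u = nth d s (path_index u) by rewrite /path_index us nth_index.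
have pu : position u = (2 * #|G|.+1) * (path_index u).+1.
  by rewrite /position us.
have iy : (path_index u <= path_index y <= path_index w) ||
          (path_index w <= path_index y <= path_index u).
  case/orP: B => /andP[/ltnW/path_index_le h1 /ltnW/path_index_le h2].
    by rewrite h1 h2.
  by rewrite h1 h2 orbT.
have ry := rank_lt y.
(* Apart from [u], the vertices with the index of [u] are leaves hanging at it, all of them
   out-neighbours. *)
have same : path_index y = path_index u -> arc u y.
  move=> yu; move: B; case: (positionP y); rewrite yu -uE // => _.
  by rewrite pu; lia.
have [/same //|yu] := eqVneq (path_index y) (path_index u).
have [ws|ws] := boolP (w \in s); last first.
  (* A head off the path hangs at [u], so [y], squeezed in between, would have the same index. *)
  suff wu : path_index w = path_index u by apply: same; lia.
  have wi := off_path_edge ws.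
  have uE' := off_path_leaf orG acyclic noK s_max ws wS wi (arc_underlyingV uw).
  by rewrite [in RHS]uE' path_index_nth.
have wE : w = nth d s (path_index w) by rewrite /path_index ws nth_index.
have pw : position w = (2 * #|G|.+1) * (path_index w).+1.
  by rewrite /position ws.
have adj : path_index w = (path_index u).+1 \/ path_index u = (path_index w).+1.
  by apply: (neighbor_index acyclic (d := d) s_path) => //; rewrite -uE -wE
    arc_underlying.
have yw : path_index y = path_index w by lia.
(* Now [y] would be a leaf at [w] on the side of [u]; being placed towards an out-neighbour of [w],
   it would give an arc from [w] to [u]. *)
exfalso; move: B; rewrite pu pw; case: (positionP y); rewrite yw.
- by lia.
- move=> _ _ aw _ B; case: adj => adj; first by nia.
  by rewrite -wE -adj -uE in aw; apply: no_back uw aw.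
- move=> _ _ aw _ B; case: adj => adj; last by nia.
  by rewrite -wE adj /= -uE in aw; apply: no_back uw aw.
Qed.

End Position.

Theorem theorem6p7 (R : realType) (G : digraph) :
  oriented G ->
  is_tree (@underlying G) ->
  (is_oriented_ICD R G <->
   [/\ ~ contains_induced G D1,
       ~ contains_induced G D2
     & ~ contains_induced G K]).
Proof.
move=> orG [G_gt0 connected acyclic]; split.
  case/ICD_order => p [p_inj p_between]; split.
  - exact: D1_free orG p_inj p_between.
  - exact: D2_free orG p_inj p_between.
  - exact: K_free orG p_inj p_between.
case=> noD1 noD2 noK; split=> //.
have [d _] := card_gt0P G_gt0.
have [s s_max] := maximal_exists d.
apply: (@order_ICD R G (position d s)).
- exact: position_inj.
- exact: position_between.
Qed.
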